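(* The following hold: (1) the only non-zero eigenvalue of $\operatorname{Re} V$ is $1/2$; (2) the non-zero eigenvalues of $\operatorname{Im} V^2$ are $\pm\sqrt{3}/12$; (3) the non-zero eigenvalues of $\operatorname{Re} V^3$ are $-1/24$ and $1/48\pm\sqrt{5}/80$; (4) the non-zero eigenvalues of $\operatorname{Im} V^4$ are $\pm\frac{\sqrt{1575\pm 84\sqrt{345}}}{5040}$ (all four choices of signs).
   Context: $L^2[0,1]$ is the complex Hilbert space of square-integrable functions on $[0,1]$. The Volterra operator $V:L^2[0,1]\to L^2[0,1]$ is defined by $Vf(x):=\int_0^x f(t)\,dt$, and its adjoint is $V^*f(x)=\int_x^1 f(t)\,dt$. For $n\ge1$, write $V^{*n}:=(V^* )^n$, $\operatorname{Re} V^n:=(V^n+V^{*n})/2$ and $\operatorname{Im} V^n:=(V^n-V^{*n})/(2i)$. *)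

(* Defs.v *)
From HB Require Import structures.
From mathcomp Require Import all_boot all_order all_algebra.
From mathcomp Require Import all_classical all_reals all_analysis.
From mathcomp Require Import measurable_realfun.
From mathcomp Require Import complex ring lra.

Set Implicit Arguments.
Unset Strict Implicit.
Unset Printing Implicit Defensive.

Import Order.TTheory GRing.Theory Num.Theory.
Import numFieldNormedType.Exports.

Local Open Scope classical_set_scope.
Local Open Scope complex_scope.
Local Open Scope quotient_scope.
Local Open Scope ring_scope.

Section RealPart.
Context {R : realType}.
Local Notation mu := (@lebesgue_measure R).
Local Notation I := (`[0%R, 1%R]%classic : set R).
Implicit Types h k : R -> R.

(* Membership in the real L^2[0, 1]; see sqintP for the link with sqint. *)
Definition rsqint h :=
  measurable_fun I h /\ mu.-integrable I (EFin \o (fun x => h x ^+ 2)).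

Lemma fin_muI : (mu I < +oo)%E.
Proof. by rewrite lebesgue_measure_itv/= lte01 EFinN sube0 ltry. Qed.

Lemma integrable_cstI (c : R) : mu.-integrable I (EFin \o cst c).
Proof.
apply: measurable_bounded_integrable => //; first exact: fin_muI.
by exists `|c|; split=> [|M cM x _ /=]; [rewrite num_real|exact: ltW].
Qed.

Lemma le_integrableR h k : measurable_fun I h ->
  mu.-integrable I (EFin \o k) -> (forall x, I x -> `|h x| <= k x) ->
  mu.-integrable I (EFin \o h).
Proof.
move=> mh ik hk; apply: (le_integrable _ _ _ ik) => //=.
  exact/measurable_EFinP.
by move=> x Ix /=; rewrite lee_fin (le_trans (hk x Ix))// ler_norm.
Qed.

Lemma integrableDR h k : mu.-integrable I (EFin \o h) ->
  mu.-integrable I (EFin \o k) -> mu.-integrable I (EFin \o (h \+ k)).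
Proof. by move=> ih ik; apply: (integrableD _ ih ik). Qed.

Lemma integrableZR c h : mu.-integrable I (EFin \o h) ->
  mu.-integrable I (EFin \o (fun x => c * h x)).
Proof. by move=> ih; apply: (integrableZl _ c ih). Qed.

Lemma rsqintD h k : rsqint h -> rsqint k -> rsqint (fun x => h x + k x).
Proof.
move=> [mh ih] [mk ik]; have mhk : measurable_fun I (fun x => h x + k x).
  exact: measurable_funD.
split=> //; apply: (@le_integrableR _ (fun x => 2 * (h x ^+ 2 + k x ^+ 2))).
- exact: measurable_funX.
- by apply: integrableZR; exact: integrableDR.
- move=> x _; rewrite ger0_norm ?sqr_ge0// -subr_ge0.
  rewrite [leRHS](_ : _ = (h x - k x) ^+ 2) ?sqr_ge0//.
  by rewrite sqrrB sqrrD; ring.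
Qed.

Lemma rsqintZ c h : rsqint h -> rsqint (fun x => c * h x).
Proof.
move=> [mh ih]; split; first exact: measurable_funM.
rewrite (_ : (fun x => _) = (fun x => c ^+ 2 * h x ^+ 2)).
  exact: integrableZR.
by apply/funext => x; rewrite exprMn.
Qed.

Lemma rsqint_bounded h C : measurable_fun I h ->
  (forall x, I x -> `|h x| <= C) -> rsqint h.
Proof.
move=> mh hC; split=> //; apply: (@le_integrableR _ (cst (C ^+ 2))).
- exact: measurable_funX.
- exact: integrable_cstI.
- move=> x Ix /=; rewrite normrX ler_sqr ?hC// nnegrE.
  exact: le_trans (hC _ Ix).
Qed.

Lemma rsqint_cst c : rsqint (cst c).
Proof. by apply: (@rsqint_bounded _ `|c|) => // x _ /=. Qed.

Lemma rsqint_integrable h : rsqint h -> mu.-integrable I (EFin \o h).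
Proof.
move=> [mh ih]; apply: (@le_integrableR _ (fun x => 1 + h x ^+ 2)) => //.
  exact: (integrableDR (integrable_cstI 1)).
move=> x _; have [h1|h1] := leP `|h x| 1.
  by rewrite (le_trans h1)// lerDl sqr_ge0.
rewrite -real_normK ?num_real// (@le_trans _ _ (`|h x| ^+ 2))// ?lerDr//.
by rewrite expr2 ler_peMr// ltW.
Qed.

Lemma rsqintM h k : rsqint h -> rsqint k ->
  mu.-integrable I (EFin \o (fun x => h x * k x)).
Proof.
move=> [mh ih] [mk ik].
apply: (@le_integrableR _ (fun x => h x ^+ 2 + k x ^+ 2)).
- exact: measurable_funM.
- exact: integrableDR.
- move=> x _; rewrite normrM -(real_normK (num_real (h x))).
  rewrite -(real_normK (num_real (k x))); nra.
Qed.

Definition rvolt h (x : R) : R := \int[mu]_(t in `[0, x]) h t.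
Definition rvoltadj h (x : R) : R := \int[mu]_(t in `[x, 1]) h t.

Lemma rvolt_rsqint h : mu.-integrable I (EFin \o h) -> rsqint (rvolt h).
Proof.
move=> ih; apply: (@rsqint_bounded _ (\int[mu]_(t in I) `|h t|)).
  apply: subspace_continuous_measurable_fun => //.
  exact: (parameterized_integral_continuous ler01 ih).
move=> x; rewrite /= in_itv/= => /andP[x0 x1].
have sub : `[0%R, x]%classic `<=` I by apply: subset_itvl; rewrite bnd_simp.
have ihx : mu.-integrable `[0%R, x] (EFin \o h) by exact: integrableS ih.
apply: (le_trans (le_normr_Rintegral _ ihx)) => //.
have ia : mu.-integrable I (EFin \o (fun t => `|h t|)).
  exact: (integrable_abse ih).
have iax : mu.-integrable `[0%R, x] (EFin \o (fun t => `|h t|)).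
  exact: integrableS ia.
rewrite /Rintegral; apply: fine_le; [exact: integrable_fin_num..|].
by apply: ge0_subset_integral => //; case/integrableP : ia.
Qed.

Lemma rvoltadjE h x : mu.-integrable I (EFin \o h) -> I x ->
  rvoltadj h x = rvolt h 1 - rvolt h x.
Proof.
move=> ih; rewrite /= in_itv/= => /andP[x0 x1].
rewrite /rvolt /rvoltadj Rintegral_itvB// ?bnd_simp//.
rewrite Rintegral_itv_obnd_cbnd//; apply: integrableS ih => //.
by apply: subset_itvr; rewrite bnd_simp.
Qed.

Lemma rvoltadj_rsqint h : mu.-integrable I (EFin \o h) -> rsqint (rvoltadj h).
Proof.
move=> ih; have : rsqint (fun x => rvolt h 1 + (-1) * rvolt h x).
  apply: rsqintD; first exact: rsqint_cst.
  exact/rsqintZ/rvolt_rsqint.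
have E x : I x -> rvoltadj h x = rvolt h 1 + -1 * rvolt h x.
  by move=> Ix; rewrite rvoltadjE// mulN1r.
case=> m i; split.
  by apply: eq_measurable_fun m => x /[!inE] /E ->.
by apply: eq_integrable i => // x /[!inE] /E /= ->.
Qed.

End RealPart.

#[global] Instance ae_lebesgue_filter (R : realType) :
  Filter (almost_everywhere (@lebesgue_measure R)).
Proof. exact: ae_filter_ringOfSetsType. Qed.

Section SquareIntegrable.
Context {R : realType}.
Local Notation mu := (@lebesgue_measure R).
Local Notation I := (`[0%R, 1%R]%classic : set R).
Implicit Types f g : R -> R[i].

(* R[i] carries no measurable structure: f is measurable iff its real and
   imaginary parts are. *)
Definition sqint : {pred R -> R[i]} := fun f =>
  `[< [/\ measurable_fun I (fun x => complex.Re (f x)),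
          measurable_fun I (fun x => complex.Im (f x)) &
          mu.-integrable I (fun x => (Normc.normc (f x) ^+ 2)%:E)] >].

Lemma normc_sqr (z : R[i]) : Normc.normc z ^+ 2 = complex.Re z ^+ 2 + complex.Im z ^+ 2.
Proof. by case: z => a b /=; rewrite sqr_sqrtr// addr_ge0 ?sqr_ge0. Qed.

Lemma sqintP f :
  f \in sqint <-> rsqint (fun x => complex.Re (f x)) /\ rsqint (fun x => complex.Im (f x)).
Proof.
split=> [/asboolP[mr mi int]|[[mr ir] [mi ii]]].
  by split; split=> //; apply: (le_integrableR _ int) => [|x _];
    rewrite ?normc_sqr ?ger0_norm ?sqr_ge0 ?lerDl ?lerDr ?sqr_ge0//;
    exact: measurable_funX.
apply/asboolP; split=> //.
rewrite (_ : (fun x => _) =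
  EFin \o ((fun x => complex.Re (f x) ^+ 2) \+ (fun x => complex.Im (f x) ^+ 2))).
  exact: integrableDR.
by apply/funext => x /=; rewrite normc_sqr.
Qed.

Lemma sqint_submod_closed : submod_closed sqint.
Proof.
split=> [|a f g /sqintP[fr fi] /sqintP[gr gi]].
  by apply/sqintP; split; exact: (rsqint_cst 0).
apply/sqintP; split.
  rewrite (_ : (fun x => _) = (fun x => (complex.Re a * complex.Re (f x) +
     (- complex.Im a) * complex.Im (f x)) + complex.Re (g x))).
    by apply: rsqintD => //; apply: rsqintD; apply: rsqintZ.
  apply/funext => x; rewrite [(a *: f + g) x]/(a * f x + g x).
  by case: a (f x) (g x) => [a b] [c d] [e h] /=; rewrite mulNr.
rewrite (_ : (fun x => _) = (fun x => (complex.Re a * complex.Im (f x) +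
   (complex.Im a) * complex.Re (f x)) + complex.Im (g x))).
  by apply: rsqintD => //; apply: rsqintD; apply: rsqintZ.
apply/funext => x; rewrite [(a *: f + g) x]/(a * f x + g x).
by case: a (f x) (g x) => [a b] [c d] [e h].
Qed.

HB.instance Definition _ :=
  GRing.isSubmodClosed.Build _ _ sqint sqint_submod_closed.

End SquareIntegrable.

Section L2.
Variable R : realType.
Local Notation mu := (@lebesgue_measure R).
Local Notation I := (`[0%R, 1%R]%classic : set R).

(* Functions are total on R; their values outside [0, 1] are identified away
   by the quotient L2 below. *)
Record sqfun := SqFun { sqval :> R -> R[i]; sqvalP : sqval \in sqint }.

HB.instance Definition _ := [isSub for sqval].
HB.instance Definition _ := [Choice of sqfun by <:].
HB.instance Definition _ := [SubChoice_isSubLmodule of sqfun by <:].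

Implicit Types f g : sqfun.

Definition aeeq : rel sqfun := fun f g => `[< f = g %[ae mu in I] >].

Lemma aeeq_refl : reflexive aeeq.
Proof. by move=> f; apply/asboolP; exact: ae_eq_refl. Qed.

Lemma aeeq_sym : symmetric aeeq.
Proof. by move=> f g; apply/asboolP/asboolP => /ae_eq_sym. Qed.

Lemma aeeq_trans : transitive aeeq.
Proof.
by move=> g f h /asboolP fg /asboolP gh; apply/asboolP; exact: ae_eq_trans gh.
Qed.

Canonical aeeq_equiv := EquivRel aeeq aeeq_refl aeeq_sym aeeq_trans.

Definition L2 : Type := {eq_quot aeeq}.
HB.instance Definition _ := Choice.on L2.
HB.instance Definition _ := EqQuotient.on L2.

Lemma L2_eqP f g : \pi_L2 f = \pi_L2 g <-> f = g %[ae mu in I].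
Proof. by split=> [/eqmodP/asboolP|fg]; [|apply/eqmodP/asboolP]. Qed.

Lemma repr_ae f : repr (\pi_L2 f) = f %[ae mu in I].
Proof. by apply/L2_eqP; rewrite reprK. Qed.

Definition L2zero : L2 := \pi_L2 0.
Definition L2opp (u : L2) : L2 := \pi_L2 (- repr u).
Definition L2add (u v : L2) : L2 := \pi_L2 (repr u + repr v).
Definition L2scale (a : R[i]) (u : L2) : L2 := \pi_L2 (a *: repr u).

Lemma piN f : \pi_L2 (- f) = L2opp (\pi_L2 f).
Proof.
apply/L2_eqP; move: (repr_ae f); apply: filterS => x /[apply] fx.
by rewrite -[LHS]/(- f x) -fx.
Qed.

Lemma piD f g : \pi_L2 (f + g) = L2add (\pi_L2 f) (\pi_L2 g).
Proof.
apply/L2_eqP; move: (repr_ae f) (repr_ae g); apply: filterS2 => x + + Ix.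
by move=> /(_ Ix) fx /(_ Ix) gx; rewrite -[LHS]/(f x + g x) -fx -gx.
Qed.

Lemma piZ a f : \pi_L2 (a *: f) = L2scale a (\pi_L2 f).
Proof.
apply/L2_eqP; move: (repr_ae f); apply: filterS => x /[apply] fx.
by rewrite -[LHS]/(a * f x) -fx.
Qed.

Lemma L2P (P : L2 -> Prop) : (forall f, P (\pi_L2 f)) -> forall u, P u.
Proof. by move=> Pf u; rewrite -[u]reprK. Qed.

Lemma L2addA : associative L2add.
Proof.
elim/L2P => f; elim/L2P => g; elim/L2P => h.
by rewrite -!piD addrA.
Qed.

Lemma L2addC : commutative L2add.
Proof. by elim/L2P => f; elim/L2P => g; rewrite -!piD addrC. Qed.

Lemma L2add0 : left_id L2zero L2add.
Proof. by elim/L2P => f; rewrite -piD add0r. Qed.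

Lemma L2addN : left_inverse L2zero L2opp L2add.
Proof. by elim/L2P => f; rewrite -piN -piD addNr. Qed.

HB.instance Definition _ :=
  GRing.isZmodule.Build L2 L2addA L2addC L2add0 L2addN.

Lemma L2scaleA a b u : L2scale a (L2scale b u) = L2scale (a * b) u.
Proof. by elim/L2P: u => f; rewrite -!piZ scalerA. Qed.

Lemma L2scale1 : left_id 1 L2scale.
Proof. by elim/L2P => f; rewrite -piZ scale1r. Qed.

Lemma L2scaleDr : right_distributive L2scale +%R.
Proof.
move=> a; elim/L2P => f; elim/L2P => g.
by rewrite -[LHS]/(L2scale a (L2add _ _)) -[RHS]/(L2add _ _)
  -piD -!piZ -piD scalerDr.
Qed.

Lemma L2scaleDl u : {morph L2scale^~ u : a b / a + b}.
Proof.
elim/L2P: u => f a b.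
by rewrite -[RHS]/(L2add _ _) -!piZ -piD scalerDl.
Qed.

HB.instance Definition _ := GRing.Zmodule_isLmodule.Build R[i] L2
  L2scaleA L2scale1 L2scaleDr L2scaleDl.

Lemma L2piD f g : \pi_L2 (f + g) = \pi_L2 f + \pi_L2 g.
Proof. exact: piD. Qed.

Lemma L2piZ a f : \pi_L2 (a *: f) = a *: \pi_L2 f.
Proof. exact: piZ. Qed.

End L2.

Section Volterra.
Variable R : realType.
Local Notation mu := (@lebesgue_measure R).
Local Notation I := (`[0%R, 1%R]%classic : set R).
Local Notation L2 := (L2 R).

Definition cintegral (A : set R) (f : R -> R[i]) : R[i] :=
  (\int[mu]_(x in A) complex.Re (f x)) +i* (\int[mu]_(x in A) complex.Im (f x)).

Implicit Types f g : sqfun R.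

Lemma volt_subproof f : (fun x => cintegral `[0, x] f) \in sqint.
Proof.
have /sqintP[fr fi] := sqvalP f.
by apply/sqintP; split; apply: rvolt_rsqint; exact: rsqint_integrable.
Qed.

Lemma voltadj_subproof f : (fun x => cintegral `[x, 1] f) \in sqint.
Proof.
have /sqintP[fr fi] := sqvalP f.
by apply/sqintP; split; apply: rvoltadj_rsqint; exact: rsqint_integrable.
Qed.

(* Independent of the representative: see volterra_pi and volterra_adj_pi. *)
Definition volterra (u : L2) : L2 := \pi_L2 (SqFun (volt_subproof (repr u))).

Definition volterra_adj (u : L2) : L2 :=
  \pi_L2 (SqFun (voltadj_subproof (repr u))).

Lemma Rintegral_ae (A : set R) (h k : R -> R) : measurable A -> A `<=` I ->
  rsqint h -> rsqint k -> h = k %[ae mu in I] ->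
  \int[mu]_(x in A) h x = \int[mu]_(x in A) k x.
Proof.
move=> mA AI [mh _] [mk _] hk; congr fine; apply: ae_eq_integral => //.
- by apply/measurable_EFinP; apply: measurable_funS mh.
- by apply/measurable_EFinP; apply: measurable_funS mk.
- by move: hk; apply: filterS => x hk Ax; rewrite hk//; exact: AI.
Qed.

Lemma cintegral_ae (A : set R) f g : measurable A -> A `<=` I ->
  f = g %[ae mu in I] -> cintegral A f = cintegral A g.
Proof.
move=> mA AI fg; have /sqintP[fr fi] := sqvalP f.
have /sqintP[gr gi] := sqvalP g.
by congr (_ +i* _); apply: Rintegral_ae => //; move: fg; apply: filterS;
  move=> x /[apply] ->.
Qed.

Lemma sub0x (x : R) : I x -> `[0, x]%classic `<=` I.
Proof.
by rewrite /= in_itv/= => /andP[_ x1]; apply: subset_itvl; rewrite bnd_simp.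
Qed.

Lemma subx1 (x : R) : I x -> `[x, 1]%classic `<=` I.
Proof.
by rewrite /= in_itv/= => /andP[x0 _]; apply: subset_itvr; rewrite bnd_simp.
Qed.

Lemma volterra_pi f : volterra (\pi_L2 f) = \pi_L2 (SqFun (volt_subproof f)).
Proof.
apply/L2_eqP/aeW => x Ix.
exact: (cintegral_ae (measurable_itv _) (sub0x Ix) (repr_ae f)).
Qed.

Lemma volterra_adj_pi f :
  volterra_adj (\pi_L2 f) = \pi_L2 (SqFun (voltadj_subproof f)).
Proof.
apply/L2_eqP/aeW => x Ix.
exact: (cintegral_ae (measurable_itv _) (subx1 Ix) (repr_ae f)).
Qed.

End Volterra.

Section Adjoint.
Context {R : realType}.
Local Notation mu := (@lebesgue_measure R).
Local Notation I := (`[0%R, 1%R]%classic : set R).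

Lemma rvolt_adjoint (h k : R -> R) : rsqint h -> rsqint k ->
  \int[mu]_(x in I) (rvolt h x * k x) = \int[mu]_(x in I) (h x * rvoltadj k x).
Proof.
move=> hh hk.
pose H := h \_ I; pose K := k \_ I.
have iH : mu.-integrable setT (EFin \o H).
  rewrite -restrict_EFin; apply/integrable_restrict => //=.
  by rewrite setTI; exact: rsqint_integrable.
have iK : mu.-integrable setT (EFin \o K).
  rewrite -restrict_EFin; apply/integrable_restrict => //=.
  by rewrite setTI; exact: rsqint_integrable.
have mH : measurable_fun setT H by case/integrableP: iH => /measurable_EFinP.
have mK : measurable_fun setT K by case/integrableP: iK => /measurable_EFinP.
pose B (z : R * R) : R := (z.2 <= z.1)%R%:R.
pose F (z : R * R) : \bar R := (K z.1 * (H z.2 * B z))%:E.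
have mB : measurable_fun [set: R * R] B.
  apply: (@measurableT_comp _ _ _ _ _ _ (fun b : bool => (b : nat)%:R : R)) => //.
  by apply: measurable_fun_ler.
have mF : measurable_fun [set: R * R] F.
  apply/measurable_EFinP; apply: measurable_funM.
    by apply: measurableT_comp.
  apply: measurable_funM => //; exact: measurableT_comp.
have iaH : mu.-integrable setT (fun y => (`|H y|)%:E) by exact: integrable_abse iH.
have iaK : mu.-integrable setT (fun x => (`|K x|)%:E) by exact: integrable_abse iK.
pose N : R := fine (\int[mu]_y (`|H y|)%:E)%E.
have NE : (\int[mu]_y (`|H y|)%:E)%E = N%:E.
  by rewrite /N fineK//; exact: integrable_fin_num.
have B1 z : `|B z| <= 1 by rewrite /B normr_nat lern1 leq_b1.
have iF : (mu \x mu)%E.-integrable setT F.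
  apply/integrable12ltyP => //.
  have iKN : mu.-integrable setT (fun x => (N%:E * (`|K x|)%:E)%E).
    exact: integrableZl.
  apply: (@le_lt_trans _ _ (\int[mu]_x (N%:E * (`|K x|)%:E))%E).
    apply: ge0_le_integral => //.
    - by move=> x _; exact: integral_ge0.
    - apply: (@measurable_fun_fubini_tonelli_F _ _ _ _ _ mu (fun z => `|F z|%E)) => //.
      exact: measurableT_comp.
    - by case/integrableP: iKN.
    - move=> x _; rewrite -NE muleC -ge0_integralZl//; last first.
        by case/integrableP: iaH.
      apply: ge0_le_integral => //.
      + by apply: measurableT_comp => //; exact: measurableT_comp mF _.
      + by apply: measurable_funeM; case/integrableP: iaH.
      + move=> y _; rewrite /F /= lee_fin !normrM ler_wpM2l//.
        by rewrite ler_piMr.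
  have : (\int[mu]_x (N%:E * (`|K x|)%:E))%E \is a fin_num.
    exact: integrable_fin_num.
  by rewrite fin_numElt => /andP[].
have E1 x : (\int[mu]_y F (x, y))%E = (((fun x => rvolt h x * k x) \_ I) x)%:E.
  have [Ix|nIx] := pselect (I x); last first.
    rewrite patchC ?inE// /F /K /= patchC ?inE//.
    by under eq_integral do rewrite mul0r; rewrite integral0.
  have HB y : H y * B (x, y) = (h \_ `[0, x]) y.
    rewrite /H /B /= !patchE.
    rewrite (_ : (y \in `[0, x]%classic) = (y \in I) && (y <= x)).
      by case: ifP; rewrite ?mul0r//= => _; case: ifP; rewrite ?mulr1 ?mulr0.
    rewrite !mem_setE !in_itv/=; move: Ix; rewrite /= in_itv/= => /andP[_ x1].
    case: (0 <= y) => //=; case: (leP y x); rewrite ?andbF// => yx.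
    by rewrite (le_trans yx x1).
  have KE : K x = k x by rewrite /K patchE mem_set.
  rewrite patchE mem_set// /F/= KE mulrC EFinM.
  under eq_integral do rewrite HB EFinM.
  have ih : mu.-integrable `[0%R, x] (EFin \o h).
    by apply: integrableS (rsqint_integrable hh) => //; exact: sub0x.
  have ihx : mu.-integrable setT (EFin \o (h \_ `[0, x])).
    by rewrite -restrict_EFin; apply/integrable_restrict => //=; rewrite setTI.
  rewrite integralZl//; congr (_ * _)%E.
  rewrite /rvolt /Rintegral fineK ?integrable_fin_num//.
  by rewrite [RHS]integral_mkcond restrict_EFin.
have E2 y : (\int[mu]_x F (x, y))%E = (((fun x => h x * rvoltadj k x) \_ I) y)%:E.
  have [Iy|nIy] := pselect (I y); last first.
    rewrite patchC ?inE// /F /H /= patchC ?inE//.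
    by under eq_integral do rewrite mul0r mulr0; rewrite integral0.
  have KB x : K x * B (x, y) = (k \_ `[y, 1]) x.
    rewrite /K /B /= !patchE.
    rewrite (_ : (x \in `[y, 1]%classic) = (x \in I) && (y <= x)).
      by case: ifP; rewrite ?mul0r//= => _; case: ifP; rewrite ?mulr1 ?mulr0.
    rewrite !mem_setE !in_itv/=; move: Iy; rewrite /= in_itv/= => /andP[y0 _].
    case: (leP y x) => yx; rewrite ?andbF//= andbT.
    by rewrite (le_trans y0 yx).
  have HE : H y = h y by rewrite /H patchE mem_set.
  rewrite patchE mem_set// /F/= HE EFinM.
  under eq_integral do rewrite mulrCA KB EFinM.
  have ik : mu.-integrable `[y, 1%R] (EFin \o k).
    by apply: integrableS (rsqint_integrable hk) => //; exact: subx1.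
  have iky : mu.-integrable setT (EFin \o (k \_ `[y, 1])).
    by rewrite -restrict_EFin; apply/integrable_restrict => //=; rewrite setTI.
  rewrite integralZl//; congr (_ * _)%E.
  rewrite /rvoltadj /Rintegral fineK ?integrable_fin_num//.
  by rewrite [RHS]integral_mkcond restrict_EFin.
rewrite Rintegral_mkcond [RHS]Rintegral_mkcond.
rewrite [LHS]/Rintegral [RHS]/Rintegral; congr fine.
transitivity (\int[mu]_x \int[mu]_y F (x, y))%E.
  by apply: eq_integral => x _; rewrite E1.
rewrite (Fubini iF).
by apply: eq_integral => y _; rewrite E2.
Qed.

End Adjoint.

Section Linearity.
Variable R : realType.
Local Notation mu := (@lebesgue_measure R).
Local Notation I := (`[0%R, 1%R]%classic : set R).
Implicit Types f g : sqfun R.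

Lemma cintegral_linear (A : set R) a f g : measurable A -> A `<=` I ->
  cintegral A (fun x => a * f x + g x) = a * cintegral A f + cintegral A g.
Proof.
move=> mA AI; have iA h : rsqint h -> mu.-integrable A (EFin \o h).
  by move=> /rsqint_integrable ih; exact: integrableS ih.
have /sqintP[/iA fr /iA fi] := sqvalP f.
have /sqintP[/iA gr /iA gi] := sqvalP g.
have iZ c h : mu.-integrable A (EFin \o h) ->
    mu.-integrable A (EFin \o (fun x => c * h x)).
  by move=> ih; apply: (integrableZl _ c ih).
have iD h k : mu.-integrable A (EFin \o h) -> mu.-integrable A (EFin \o k) ->
    mu.-integrable A (EFin \o (fun x => h x + k x)).
  by move=> ih ik; apply: (integrableD _ ih ik).
case: a => a b; rewrite /cintegral; simpc.
rewrite -!mulNr -!RintegralZl// -!RintegralD//;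
  try by [exact: iZ|apply: iD; exact: iZ].
congr (_ +i* _); apply: eq_Rintegral => x _.
  by case: (f x) (g x) => [? ?] [? ?] /=; rewrite mulNr.
by case: (f x) (g x) => [? ?] [? ?] /=.
Qed.

Lemma volterra_linear : linear (@volterra R).
Proof.
move=> a; elim/L2P => f; elim/L2P => g.
rewrite -L2piZ -L2piD !volterra_pi -L2piZ -L2piD.
apply/L2_eqP/aeW => x Ix.
exact: (cintegral_linear a f g (measurable_itv _) (sub0x Ix)).
Qed.

Lemma volterra_adj_linear : linear (@volterra_adj R).
Proof.
move=> a; elim/L2P => f; elim/L2P => g.
rewrite -L2piZ -L2piD !volterra_adj_pi -L2piZ -L2piD.
apply/L2_eqP/aeW => x Ix.
exact: (cintegral_linear a f g (measurable_itv _) (subx1 Ix)).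
Qed.

HB.instance Definition _ :=
  GRing.isLinear.Build R[i] (L2 R) (L2 R) _ (@volterra R) volterra_linear.
HB.instance Definition _ :=
  GRing.isLinear.Build R[i] (L2 R) (L2 R) _ (@volterra_adj R) volterra_adj_linear.

End Linearity.

Section InnerProduct.
Context {R : realType}.
Local Notation mu := (@lebesgue_measure R).
Local Notation I := (`[0%R, 1%R]%classic : set R).
Implicit Types f g : sqfun R.

Definition dotf f g : R[i] := cintegral I (fun x => f x * (g x)^*%C).

Definition L2dot (u v : L2 R) : R[i] := dotf (repr u) (repr v).

Definition rdot (h k : R -> R) : R := \int[mu]_(x in I) (h x * k x).

Lemma dotfE f g :
  let fr x := complex.Re (f x) in let fi x := complex.Im (f x) in
  let gr x := complex.Re (g x) in let gi x := complex.Im (g x) in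
  dotf f g = (rdot fr gr + rdot fi gi) +i* (rdot fi gr - rdot fr gi).
Proof.
move=> fr fi gr gi; have /sqintP[hfr hfi] := sqvalP f.
have /sqintP[hgr hgi] := sqvalP g.
rewrite /dotf /cintegral /rdot -RintegralD//; try exact: rsqintM.
rewrite -RintegralB//; try exact: rsqintM.
congr (_ +i* _); apply: eq_Rintegral => x _; rewrite /fr /fi /gr /gi.
  by case: (f x) (g x) => [a b] [c d] /=; rewrite mulrN opprK.
by case: (f x) (g x) => [a b] [c d] /=; rewrite mulrN addrC.
Qed.

Lemma rdot_ae (h h' k k' : R -> R) : rsqint h -> rsqint h' ->
  rsqint k -> rsqint k' -> h = h' %[ae mu in I] -> k = k' %[ae mu in I] ->
  rdot h k = rdot h' k'.
Proof.
move=> [mh _] [mh' _] [mk _] [mk' _] hh' kk'.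
congr fine; apply: ae_eq_integral => //.
- by apply/measurable_EFinP; exact: measurable_funM.
- by apply/measurable_EFinP; exact: measurable_funM.
- move: hh' kk'; apply: filterS2 => x hx kx Ix.
  by rewrite /= hx// kx.
Qed.

Lemma L2dot_pi f g : L2dot (\pi_(L2 R) f) (\pi_(L2 R) g) = dotf f g.
Proof.
rewrite /L2dot !dotfE.
have ae_re (f1 f2 : sqfun R) : f1 = f2 %[ae mu in I] ->
    (fun x => complex.Re (f1 x)) = (fun x => complex.Re (f2 x)) %[ae mu in I].
  by apply: filterS => x /[apply] ->.
have ae_im (f1 f2 : sqfun R) : f1 = f2 %[ae mu in I] ->
    (fun x => complex.Im (f1 x)) = (fun x => complex.Im (f2 x)) %[ae mu in I].
  by apply: filterS => x /[apply] ->.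
have sr (f1 : sqfun R) := (sqintP f1).1 (sqvalP f1).
have ff := repr_ae f; have gg := repr_ae g.
congr ((_ + _) +i* (_ - _)); apply: rdot_ae;
  by [exact: (sr _).1|exact: (sr _).2|exact: ae_re|exact: ae_im].
Qed.

Lemma volterra_adjoint (u v : L2 R) :
  L2dot (volterra u) v = L2dot u (volterra_adj v).
Proof.
elim/L2P: u => f; elim/L2P: v => g.
rewrite volterra_pi volterra_adj_pi !L2dot_pi !dotfE.
have /sqintP[hfr hfi] := sqvalP f; have /sqintP[hgr hgi] := sqvalP g.
by congr ((_ + _) +i* (_ - _)); exact: rvolt_adjoint.
Qed.

End InnerProduct.

Section Main.
Variable R : realType.

(* Re V^n and Im V^n, not (Re V)^n and (Im V)^n. *)
Definition Re_volterra (n : nat) (u : L2 R) : L2 R :=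
  2^-1 *: (iter n (@volterra R) u + iter n (@volterra_adj R) u).

Definition Im_volterra (n : nat) (u : L2 R) : L2 R :=
  (2 * 'i%C)^-1 *: (iter n (@volterra R) u - iter n (@volterra_adj R) u).

End Main.

Definition is_eigenvalue (K : pzRingType) (E : lmodType K) (T : E -> E) (l : K) :=
  exists2 u : E, u != 0 & T u = l *: u.

Definition nonzero_eigenvalues (K : pzRingType) (E : lmodType K) (T : E -> E) :=
  [set l : K | l != 0 /\ is_eigenvalue T l].

(* Main.v *)
(* Write V' for the adjoint of V.  The sum V + V' is the rank-one operator
   u |-> <u, 1> 1, so the difference V^n - (-V')^n telescopes into the rank-n
   operator u |-> \sum_(k < n) <V^(n-1-k) u, 1> (-1)^k V'^k 1, where
   V'^k 1 = (1 - x)^k / k!.  For n odd this is 2 Re V^n and for n even it is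
   2i Im V^n.  The nonzero eigenvalues are therefore the nonzero roots of an
   n x n determinant whose entries come from
   <V^j V'^k 1, 1> = <V'^k 1, V'^j 1> = 1 / (j! k! (j + k + 1)). *)
Require Import Defs.
From HB Require Import structures.
From mathcomp Require Import all_boot all_order all_algebra.
From mathcomp Require Import all_classical all_reals all_analysis.
From mathcomp Require Import measurable_realfun complex ring lra.

Import Order.TTheory GRing.Theory Num.Theory.
Import numFieldNormedType.Exports.

Local Open Scope classical_set_scope.
Local Open Scope complex_scope.
Local Open Scope ring_scope.

(** * Eigenvalues of finite-rank operators *)

(** If [T u = l *: u], the row of the [phi k u] is a left null vector; it is nonzero because [T u],
    hence [u], vanishes when all [phi k u] do. Conversely a left null row [w] gives the eigenvector
    [\sum_k w 0 k *: f k]. The [f k] may be dependent: the values of [phi] on this vector recover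
    [w] because [l != 0]. *)
Lemma finite_rank_eigenvalue (K : fieldType) (E : lmodType K) (n : nat)
    (phi : 'I_n -> {scalar E}) (f : 'I_n -> E) (c : K) (T : E -> E) (l : K) :
    (forall u, T u = c *: \sum_k phi k u *: f k) -> l != 0 ->
  is_eigenvalue T l <->
  \det (l%:M - c *: \matrix_(k, j) phi j (f k)) = 0.
Proof.
move=> TE l0; set G := \matrix_(k, j) _.
have phiG (w : 'rV_n) j : phi j (\sum_k w 0 k *: f k) = (w *m G) 0 j.
  rewrite linear_sum mxE; apply: eq_bigr => k _.
  by rewrite linearZ/= mxE.
split=> [[u u0 Tu]|/eqP/det0P[w w0 /eqP]].
  apply/eqP/det0P; exists (\row_k phi k u).
    apply: contra_neq u0 => /rowP phi0; apply: (scalerI l0).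
    rewrite -Tu TE big1 ?scaler0// => k _.
    by have := phi0 k; rewrite !mxE => ->; rewrite scale0r.
  apply/eqP; rewrite mulmxBr subr_eq0 mul_mx_scalar -scalemxAr eq_sym.
  apply/eqP/rowP => j.
  have := congr1 (phi j) Tu; rewrite TE !linearZ/= => phiTu.
  rewrite mxE [RHS]mxE [X in _ = l * X]mxE -phiTu -phiG.
  by congr (_ * phi j _); apply: eq_bigr => k _; rewrite mxE.
rewrite mulmxBr subr_eq0 mul_mx_scalar -scalemxAr => /eqP wG.
have phiw j : c * phi j (\sum_k w 0 k *: f k) = l * w 0 j.
  by rewrite phiG; have /rowP/(_ j) := wG; rewrite !mxE => ->.
exists (\sum_k w 0 k *: f k).
  apply: contra_neq w0 => u0; apply/rowP => j; rewrite mxE.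
  by apply/eqP; rewrite -(mulrI_eq0 _ (mulfI l0)) -phiw u0 linear0 mulr0.
by rewrite TE !scaler_sumr; apply: eq_bigr => k _; rewrite !scalerA phiw.
Qed.

(** * Characteristic determinants of orders 1 to 4 *)

(** Indexed by naturals so that it unfolds, for a numeral [n], to an explicit expression in the
    entries; the permutation sum behind [\det] does not. *)
Fixpoint laplace {K : comNzRingType} (n : nat) (F : nat -> nat -> K) : K :=
  if n is m.+1 then
    \sum_(j < n) F 0 j * ((-1) ^+ j *
       laplace m (fun i k => F i.+1 (bump j k)))
  else 1.

Lemma det_laplace (K : comNzRingType) (n : nat) (F : nat -> nat -> K) :
  \det (\matrix_(i < n, j < n) F i j) = laplace n F.
Proof.
elim: n F => [|n IHn] F; first by rewrite det_mx00.
rewrite (expand_det_row _ ord0) /=; apply: eq_bigr => j _.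
rewrite mxE /cofactor add0n -IHn; congr (_ * (_ * \det _)).
by apply/matrixP => i k; rewrite !mxE.
Qed.

(* The matrix of l - c (V^n - (-V')^n), from the vectors (-1)^k V'^k 1 and the
   functionals <V^(n-1-j) u, 1>. *)
Definition char_entry {K : fieldType} (n : nat) (c l : K) (k j : nat) : K :=
  l *+ (k == j) -
  c * ((-1) ^+ k / ((n - j.+1)`! * k`! * (n - j.+1 + k).+1)%:R).

Definition char_det {K : fieldType} (n : nat) (c l : K) : K :=
  \det (\matrix_(k < n, j < n) char_entry n c l k j).

Lemma char_det1 (K : numFieldType) (c l : K) : char_det 1 c l = l - c.
Proof.
rewrite /char_det det_laplace /= !big_ord_recl !big_ord0 /char_entry.
rewrite /= /bump /= /addn /subn /= /muln /=.
by field; rewrite ?pnatr_eq0.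
Qed.

Lemma char_det2 (K : numFieldType) (c l : K) :
  char_det 2 c l = l ^+ 2 + c ^+ 2 / 12.
Proof.
rewrite /char_det det_laplace /= !big_ord_recl !big_ord0 /char_entry.
rewrite /= /bump /= /addn /subn /= /muln /=.
by field; rewrite ?pnatr_eq0.
Qed.

(** The cubic has the rational root [- c / 12]; splitting it off leaves a quadratic, of discriminant
    c^2 / 80. *)
Lemma char_det3 (K : numFieldType) (c l : K) :
  char_det 3 c l = (l + c / 12) * (l ^+ 2 - l * c / 12 - c ^+ 2 / 720).
Proof.
rewrite /char_det det_laplace /= !big_ord_recl !big_ord0 /char_entry.
rewrite /= /bump /= /addn /subn /= /muln /=.
by field; rewrite ?pnatr_eq0.
Qed.

(* The constant 870912000 is kept factored: numerals are unary naturals. *)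
Lemma char_det4 (K : numFieldType) (c l : K) :
  char_det 4 c l = l ^+ 4 + c ^+ 2 * l ^+ 2 / 2016
    + c ^+ 4 / (6048 * 1000 * 144).
Proof.
rewrite /char_det det_laplace /= !big_ord_recl !big_ord0 /char_entry.
rewrite /= /bump /= /addn /subn /= /muln /=.
by field; rewrite ?pnatr_eq0.
Qed.

(** * Moments and the telescoping of powers of V *)

Section Moments.
Local Open Scope quotient_scope.
Local Open Scope ring_scope.
Context {R : realType}.
Local Notation mu := (@lebesgue_measure R).
Local Notation I := (`[0%R, 1%R]%classic : set R).
Local Notation L2 := (L2 R).
Local Notation V := (@volterra R).
Local Notation V' := (@volterra_adj R).
Implicit Types u v : L2.

Lemma continuous_expr1B (k : nat) : continuous (fun t : R => (1 - t) ^+ k).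
Proof.
move=> t; apply: (@continuous_comp _ _ _ (fun t : R => 1 - t) (fun y => y ^+ k)).
  by apply: continuousB; [exact: cst_continuous|exact: cvg_id].
exact: exprn_continuous.
Qed.

Lemma Rintegral_expr1B (k : nat) (x : R) : x <= 1 ->
  \int[mu]_(t in `[x, 1]) ((1 - t) ^+ k) = (1 - x) ^+ k.+1 / k.+1%:R.
Proof.
(* The fundamental theorem of calculus needs [x < 1]; at [x = 1] both sides are 0. *)
rewrite le_eqVlt => /predU1P[->|x1].
  by rewrite set_itv1 Rintegral_set1 subrr expr0n mul0r.
pose F (t : R) := - ((1 - t) ^+ k.+1 / k.+1%:R).
have dF (t : R) : is_derive t 1 F ((1 - t) ^+ k).
  have d1 : is_derive t 1 (fun t : R => 1 - t) (- 1).
    have := is_deriveB (is_derive_cst (1 : R) t 1) (is_derive_id t 1).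
    by rewrite sub0r.
  have FE : F = - (k.+1%:R^-1 \*: (fun t : R => 1 - t) ^+ k.+1).
    by apply/funext => y; rewrite /F mulrC !fctE.
  rewrite FE.
  apply: is_derive_eq (is_deriveN (is_deriveZ _ (is_deriveX _ d1))) _.
  rewrite /GRing.scale/= mulrN1 mulrN opprK.
  by rewrite mulrA mulVf ?mul1r ?pnatr_eq0.
rewrite /Rintegral (@continuous_FTC2 _ _ F)//.
- by rewrite -EFinB/= /F subrr expr0n mul0r oppr0 sub0r opprK.
- exact/continuous_subspaceT/continuous_expr1B.
- have cF : continuous F.
    by move=> t; apply: differentiable_continuous; apply/derivable1_diffP.
  split.
  + by move=> t _; exact: ex_derive.
  + exact/cvg_at_right_filter/cF.
  + exact/cvg_at_left_filter/cF.
- by move=> t _; rewrite derive1E; exact: derive_val.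
Qed.

Lemma real_sqint (h : R -> R) : rsqint h -> (fun x => (h x)%:C) \in sqint.
Proof. by move=> hh; apply/sqintP; split => //; exact: (rsqint_cst 0). Qed.

Lemma expr1B_rsqint (k : nat) : rsqint (fun x : R => (1 - x) ^+ k / k`!%:R).
Proof.
rewrite (_ : (fun _ => _) = (fun x : R => k`!%:R^-1 * (1 - x) ^+ k)).
  apply: rsqintZ; apply: (@rsqint_bounded _ _ 1).
    apply: subspace_continuous_measurable_fun => //.
    exact/continuous_subspaceT/continuous_expr1B.
  move=> x; rewrite /= in_itv/= => /andP[x0 x1].
  have ? : 0 <= 1 - x by rewrite subr_ge0.
  by rewrite normrX ger0_norm// exprn_ile1// gerBl.
by apply/funext => x; rewrite mulrC.
Qed.

Lemma cintegral_real (A : set R) (h : R -> R) : measurable A ->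
  cintegral A (fun x => (h x)%:C) = (\int[mu]_(x in A) h x)%:C.
Proof. by move=> mA; rewrite /cintegral Rintegral_cst ?mul0r. Qed.

(** The function (1 - x)^k / k!, whose formula sits inside the membership proof. *)
Definition pow1B (k : nat) : sqfun R := SqFun (real_sqint _ (expr1B_rsqint k)).

Lemma pow1B0 x : pow1B 0 x = 1.
Proof. by rewrite /= fact0 divr1. Qed.

Definition L2one : L2 := \pi_L2 (pow1B 0).

Lemma iter_adj_one k : iter k V' L2one = \pi_L2 (pow1B k).
Proof.
elim: k => // k IHk; rewrite iterS IHk volterra_adj_pi.
apply/L2_eqP/aeW => x; rewrite /= in_itv/= => /andP[x0 x1].
rewrite [LHS](cintegral_real _ _ (measurable_itv _)); congr _%:C.
rewrite RintegralZr//; last first.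
  apply: continuous_compact_integrable; first exact: segment_compact.
  exact/continuous_subspaceT/continuous_expr1B.
by rewrite Rintegral_expr1B// factS natrM invfM mulrA.
Qed.

(* By adjunction this is the integral of u (1 - x)^j / j! over [0, 1]. *)
Definition moment (j : nat) u : R[i] := L2dot (iter j V u) L2one.

Lemma mean_pi (f : sqfun R) : L2dot (\pi_L2 f) L2one = cintegral I f.
Proof.
rewrite L2dot_pi; congr cintegral; apply/funext => x.
by rewrite pow1B0 conjc1 mulr1.
Qed.

Lemma mean_linear : scalar (L2dot^~ L2one).
Proof.
move=> a; elim/L2P => f; elim/L2P => g.
by rewrite -L2piZ -L2piD !mean_pi -cintegral_linear.
Qed.

Lemma iter_linear (K : pzRingType) (E : lmodType K) (T : {linear E -> E}) n :
  linear (iter n T).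
Proof. by move=> a x y; elim: n => //= n ->; rewrite linearP. Qed.

HB.instance Definition _
    (K : pzRingType) (E : lmodType K) (T : {linear E -> E}) n :=
  GRing.isLinear.Build K E E _ (iter n T) (iter_linear _ _ T n).

Lemma moment_linear j : scalar (moment j).
Proof. by move=> a u v; rewrite /moment linearP mean_linear. Qed.

HB.instance Definition _ j :=
  GRing.isLinear.Build R[i] L2 R[i] _ (moment j) (moment_linear j).

(** The integrals over [0, x] and [x, 1] add up to the integral over [0, 1], which does not depend
    on x. *)
Lemma volterra_add_adj u : V u + V' u = moment 0 u *: L2one.
Proof.
elim/L2P: u => f; rewrite /moment/= mean_pi volterra_pi volterra_adj_pi -L2piZ.
rewrite -L2piD; apply/L2_eqP/aeW => x Ix.
have /sqintP[/rsqint_integrable fr /rsqint_integrable fi] := sqvalP f.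
rewrite -[LHS]/(cintegral _ f + cintegral _ f).
rewrite -[RHS]/(cintegral I f * pow1B 0 x) pow1B0 mulr1.
have E h : mu.-integrable I (EFin \o h) ->
    \int[mu]_(t in `[0, x]) h t + \int[mu]_(t in `[x, 1]) h t =
    \int[mu]_(t in I) h t.
  by move=> ih; have := rvoltadjE ih Ix; rewrite /rvolt /rvoltadj => ->;
     rewrite addrC subrK.
by rewrite /cintegral -(E _ fr) -(E _ fi).
Qed.

Lemma iter_volterra_adjoint n u v :
  L2dot (iter n V u) v = L2dot u (iter n V' v).
Proof.
by elim: n u v => // n IHn u v; rewrite iterS volterra_adjoint IHn -iterSr.
Qed.

(** Moving V^j across the inner product leaves two explicit real polynomials in 1 - x, so no power
    of V has to be computed. *)
Lemma moment_adj_one j k :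
  moment j (iter k V' L2one) =
  ((j`! * k`! * (j + k).+1)%:R^-1 : R)%:C.
Proof.
rewrite /moment iter_volterra_adjoint !iter_adj_one L2dot_pi /dotf.
rewrite (_ : (fun _ => _) =
    fun x => ((1 - x) ^+ k / k`!%:R * ((1 - x) ^+ j / j`!%:R))%:C); last first.
  by apply/funext => x; rewrite [in RHS]rmorphM/= oppr0.
rewrite cintegral_real//; congr _%:C.
transitivity (\int[mu]_(x in I) ((j`! * k`!)%:R^-1 * (1 - x) ^+ (j + k))).
  by apply: eq_Rintegral => x _; rewrite exprD natrM invfM; ring.
rewrite RintegralZl//; last first.
  apply: continuous_compact_integrable; first exact: segment_compact.
  exact/continuous_subspaceT/continuous_expr1B.
by rewrite Rintegral_expr1B// subr0 expr1n mul1r -invfM -natrM.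
Qed.

Lemma iter_volterraE n u :
  iter n V u = (-1) ^+ n *: iter n V' u +
    \sum_(k < n) moment (n - k.+1) u *: ((-1) ^+ k *: iter k V' L2one).
Proof.
elim: n u => [|n IHn] u; first by rewrite big_ord0 addr0 scale1r.
(* Induction peels off the innermost V: the hypothesis is applied to V u, whose moments are those of
   u shifted by one. Only V'^n (V u) is rewritten with [VE]; it yields the new leading term and the
   summand [k = n]. *)
have VE : V u = moment 0 u *: L2one - V' u by rewrite -volterra_add_adj addrK.
rewrite iterSr IHn big_ord_recr/= subnn [in iter n V' _]VE linearB linearZ/=.
rewrite scalerBr -iterSr -scaleN1r scalerA exprSr !scalerA.
rewrite [_ * -1]mulrC [_ * moment 0 u]mulrC.
rewrite -iterS -addrA addrC -addrA; congr (_ + _); congr (_ + _).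
by apply: eq_bigr => k _; rewrite subSS /moment -iterSr subnSK.
Qed.

End Moments.

(** * Nonzero eigenvalues as roots of a determinant *)

Section Spectrum.
Context {R : realType}.
Local Notation V := (@volterra R).
Local Notation V' := (@volterra_adj R).

(** A general [c] covers both cases: 1/2 for the real parts with n odd, 1/(2i) for the imaginary
    parts with n even. *)
Lemma nonzero_eigenvalues_volterra n (c : R[i]) (T : L2 R -> L2 R) :
    (forall u, T u = c *: (iter n V u - (-1) ^+ n *: iter n V' u)) ->
  nonzero_eigenvalues T = [set l | l != 0 /\ char_det n c l = 0].
Proof.
move=> TE; pose f (k : 'I_n) : L2 R := (-1) ^+ k *: iter k V' L2one.
have TE' u : T u = c *: \sum_(k < n) moment (n - k.+1) u *: f k.
  by rewrite TE iter_volterraE addrAC subrr add0r.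
suff detE l : char_det n c l =
    \det (l%:M - c *: \matrix_(k < n, j < n) moment (n - j.+1) (f k)).
  apply/seteqP; split=> l /= [l0].
    move=> /(finite_rank_eigenvalue _ _ n _ _ c _ _ TE' l0) dl.
    by split=> //; rewrite detE.
  rewrite detE => dl; split=> //.
  exact/(finite_rank_eigenvalue _ _ n _ _ c _ _ TE' l0).
congr (\det _); apply/matrixP => k j.
rewrite !mxE /char_entry /f [moment _ _]linearZ/=.
by rewrite moment_adj_one fmorphV rmorph_nat.
Qed.

Lemma Re_volterraE n u : odd n ->
  Re_volterra n u = 2^-1 *: (iter n V u - (-1) ^+ n *: iter n V' u).
Proof. by move=> on; rewrite -signr_odd on scaleN1r opprK. Qed.

Lemma Im_volterraE n u : ~~ odd n ->
  Im_volterra n u = (2 * 'i%C)^-1 *: (iter n V u - (-1) ^+ n *: iter n V' u).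
Proof. by move=> /negbTE en; rewrite -signr_odd en scale1r. Qed.

(** * Factoring the characteristic polynomials *)

(** [char_det 2] and [char_det 4] involve [c] only through its square, so this removes i from the
    computation. *)
Lemma invr_2i_sqr : ((2 * 'i%C)^-1) ^+ 2 = - 4^-1 :> R[i].
Proof. by rewrite exprVn exprMn sqr_i mulrN1 invrN; congr (- _^-1); ring. Qed.

(** Here and below, square roots are abstract elements with prescribed squares, which turns each
    factorisation into a rational identity. *)
Lemma char_det2_factor (K : numFieldType) (c s l : K) :
    c ^+ 2 = - 4^-1 -> s ^+ 2 = 3 ->
  char_det 2 c l = (l - s / 12) * (l - - (s / 12)).
Proof.
move=> c2 s2; rewrite char_det2 c2 opprK -subr_sqr [(s / _) ^+ 2]exprMn s2.
by field.
Qed.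

Lemma char_det3_factor (K : numFieldType) (s l : K) : s ^+ 2 = 5 ->
  char_det 3 2^-1 l =
  (l - - (1 / 24)) * ((l - (1 / 48 + s / 80)) * (l - (1 / 48 - s / 80))).
Proof.
move=> s2; rewrite char_det3.
(* Completing the square at c = 1/2: the constant left over is 1/1280 = 5/80^2. *)
rewrite [X in _ = _ * X](_ : _ = (l - 1 / 48) ^+ 2 - s ^+ 2 / 80 ^+ 2).
  by rewrite s2; field.
by field.
Qed.

Lemma char_det4_factor (K : numFieldType) (c t a b l : K) :
    c ^+ 2 = - 4^-1 -> t ^+ 2 = 345 ->
    a ^+ 2 = 1575 + 84 * t -> b ^+ 2 = 1575 - 84 * t ->
  char_det 4 c l =
  (l - a / 5040) * (l - - (a / 5040)) * ((l - b / 5040) * (l - - (b / 5040))).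
Proof.
move=> c2 t2 a2 b2; rewrite char_det4 (exprM c 2 2) c2.
rewrite !opprK -!subr_sqr [(a / _) ^+ 2]exprMn [(b / _) ^+ 2]exprMn a2 b2.
(* As a difference of squares, the product contains [t] only through [t ^+ 2]. *)
rewrite [RHS](_ : _ = (l ^+ 2 - 1575 / 5040 ^+ 2) ^+ 2 -
  84 ^+ 2 * t ^+ 2 / 5040 ^+ 4); last by field.
by rewrite t2; field.
Qed.

(** The constant terms are nonzero rational multiples of powers of [c]. With 0 excluded as a root,
    the listed roots need no separate nonvanishing proofs. *)
Lemma char_det_neq0 (K : numFieldType) (c : K) : c != 0 ->
  [/\ char_det 1 c 0 != 0, char_det 2 c 0 != 0,
      char_det 3 c 0 != 0 & char_det 4 c 0 != 0].
Proof.
move=> c0; rewrite char_det1 char_det2 char_det3 char_det4; split.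
- by rewrite sub0r oppr_eq0.
- by rewrite expr0n/= add0r !mulf_neq0 ?expf_neq0 ?invr_neq0 ?pnatr_eq0.
- rewrite (_ : _ * _ = - (c ^+ 3 / (12 * 720))); last by field.
  by rewrite oppr_eq0 !mulf_neq0 ?expf_neq0 ?invr_neq0 ?mulf_neq0 ?pnatr_eq0.
- rewrite !expr0n/= mulr0 mul0r !add0r.
  by rewrite !mulf_neq0 ?expf_neq0 ?invr_neq0 ?mulf_neq0 ?pnatr_eq0.
Qed.

Lemma nonzero_rootsE (K : pzRingType) (P : K -> K) (A : set K) :
  P 0 != 0 -> (forall l, P l = 0 <-> A l) -> [set l | l != 0 /\ P l = 0] = A.
Proof.
move=> P0 PA; apply/seteqP; split=> [l [_ /PA]//|l /PA Pl].
by split=> //; apply/eqP => l0; move: P0; rewrite -l0 Pl l0 eqxx.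
Qed.

Lemma nonzero_roots2 (K : fieldType) (P : K -> K) (x y : K) :
    P 0 != 0 -> (forall l, P l = (l - x) * (l - y)) ->
  [set l | l != 0 /\ P l = 0] = [set x; y].
Proof.
move=> P0 PE; apply: nonzero_rootsE => // l; rewrite PE.
split=> [/eqP|[]->]; rewrite ?subrr ?mulr0 ?mul0r//.
by rewrite mulf_eq0 !subr_eq0 => /orP[]/eqP ->; [left|right].
Qed.

Lemma nonzero_roots3 (K : fieldType) (P : K -> K) (x y z : K) :
    P 0 != 0 -> (forall l, P l = (l - x) * ((l - y) * (l - z))) ->
  [set l | l != 0 /\ P l = 0] = [set x; y; z].
Proof.
move=> P0 PE; apply: nonzero_rootsE => // l; rewrite PE.
split=> [/eqP|[[]|]->]; rewrite ?subrr ?mulr0 ?mul0r ?mulr0//.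
by rewrite !mulf_eq0 !subr_eq0 => /or3P[]/eqP ->;
  [left; left|left; right|right].
Qed.

Lemma nonzero_roots4 (K : fieldType) (P : K -> K) (x y z w : K) :
    P 0 != 0 -> (forall l, P l = (l - x) * (l - y) * ((l - z) * (l - w))) ->
  [set l | l != 0 /\ P l = 0] = [set x; y; z; w].
Proof.
move=> P0 PE; apply: nonzero_rootsE => // l; rewrite PE.
split=> [/eqP|[[[]|]|]->]; rewrite ?subrr ?mulr0 ?mul0r ?mulr0//.
rewrite !mulf_eq0 !subr_eq0.
by move=> /orP[]/orP[]/eqP ->; [do 3 left|do 2 left; right|left; right|right].
Qed.

End Spectrum.

Theorem theorem2p3 (R : realType) :
  [/\ nonzero_eigenvalues (@Re_volterra R 1) = [set (1 / 2 : R)%:C],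
      nonzero_eigenvalues (@Im_volterra R 2) =
        [set (Num.sqrt 3 / 12 : R)%:C; (- (Num.sqrt 3 / 12) : R)%:C],
      nonzero_eigenvalues (@Re_volterra R 3) =
        [set (- (1 / 24) : R)%:C;
             (1 / 48 + Num.sqrt 5 / 80 : R)%:C;
             (1 / 48 - Num.sqrt 5 / 80 : R)%:C] &
      nonzero_eigenvalues (@Im_volterra R 4) =
        [set (Num.sqrt (1575 + 84 * Num.sqrt 345) / 5040 : R)%:C;
             (- (Num.sqrt (1575 + 84 * Num.sqrt 345) / 5040) : R)%:C;
             (Num.sqrt (1575 - 84 * Num.sqrt 345) / 5040 : R)%:C;
             (- (Num.sqrt (1575 - 84 * Num.sqrt 345) / 5040) : R)%:C] ].
Proof.
have h0 : 2^-1 != 0 :> R[i] by rewrite invr_eq0 pnatr_eq0.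
have i0 : (2 * 'i%C)^-1 != 0 :> R[i].
  by rewrite -sqrf_eq0 invr_2i_sqr oppr_eq0 invr_eq0 pnatr_eq0.
have [P1 _ P3 _] := char_det_neq0 _ _ h0.
have [_ P2 _ P4] := char_det_neq0 _ _ i0.
(* Carries the defining equations of the real square roots over to R[i]. *)
have sqrC (x y : R) : x ^+ 2 = y -> x%:C ^+ 2 = y%:C.
  by move=> <-; rewrite rmorphXn.
split.
- rewrite (nonzero_eigenvalues_volterra 1 2^-1) => [|u];
    last exact: Re_volterraE.
  rewrite mul1r fmorphV rmorph_nat.
  apply: nonzero_rootsE => // l; rewrite char_det1.
  by split=> [/subr0_eq//|->]; rewrite subrr.
- rewrite (nonzero_eigenvalues_volterra 2 (2 * 'i%C)^-1) => [|u];
    last exact: Im_volterraE.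
  have s2 : (Num.sqrt 3 : R)%:C ^+ 2 = 3.
    by rewrite (sqrC _ _ (sqr_sqrtr (ler0n _ 3))) rmorph_nat.
  rewrite rmorphN !fmorph_div !rmorph_nat.
  apply: nonzero_roots2 => // l; exact: char_det2_factor invr_2i_sqr s2.
- rewrite (nonzero_eigenvalues_volterra 3 2^-1) => [|u];
    last exact: Re_volterraE.
  have s2 : (Num.sqrt 5 : R)%:C ^+ 2 = 5.
    by rewrite (sqrC _ _ (sqr_sqrtr (ler0n _ 5))) rmorph_nat.
  rewrite rmorphN rmorphD rmorphB !fmorph_div !rmorph_nat rmorph1.
  apply: nonzero_roots3 => // l; exact: char_det3_factor s2.
- rewrite (nonzero_eigenvalues_volterra 4 (2 * 'i%C)^-1) => [|u];
    last exact: Im_volterraE.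
  have /sqr_sqrtr t2 := ler0n R 345; have t0 := sqrtr_ge0 (345 : R).
  (* Since 84^2 * 345 = 2434320 <= 1575^2 = 2480625, the inner radicand is nonnegative and
     [Num.sqrt] does not take its default value 0 there. *)
  have t_le : 84 * Num.sqrt 345 <= 1575 :> R by nra.
  have /sqr_sqrtr a2 : 0 <= 1575 + 84 * Num.sqrt 345 :> R by lra.
  have /sqr_sqrtr b2 : 0 <= 1575 - 84 * Num.sqrt 345 :> R by lra.
  move/sqrC: t2; rewrite rmorph_nat => t2.
  move/sqrC: a2; rewrite rmorphD rmorphM !rmorph_nat => a2.
  move/sqrC: b2; rewrite rmorphB rmorphM !rmorph_nat => b2.
  rewrite !rmorphN !fmorph_div !rmorph_nat.
  apply: nonzero_roots4 => // l; exact: char_det4_factor invr_2i_sqr t2 a2 b2.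
Qed.
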